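(* Let $f,g\colon X\to\overline{\mathbb{R}}$ be proper functions with $g$ e-convex, and let $\varepsilon\ge0$. If $a\in X$ is an $\varepsilon$-minimizer of $f-g$, then, for all $\lambda\ge0$, $\partial_{c,\lambda}g(a)\subseteq\partial_{c,\varepsilon+\lambda}f(a)$.
   Context: $X$ is a nontrivial separated (Hausdorff) real locally convex space with continuous dual $X^*$; $X$ carries the topology $\sigma(X,X^* )$ and $X^*$ the topology $\sigma(X^*,X)$; $\langle x,x^*\rangle$ is the value of $x^*\in X^*$ at $x\in X$. $\overline{\mathbb{R}}=\mathbb{R}\cup\{\pm\infty\}$. $W:=X^*\times X^*\times\mathbb{R}$. For an extended-real-valued function $h$, $\operatorname{dom}h=\{h<+\infty\}$; $h$ is proper if it never takes the value $-\infty$ and $\operatorname{dom}h\neq\emptyset$. The function $f-g$ is defined pointwise with the convention $(+\infty)-(+\infty)=+\infty$. For $\varepsilon\ge0$, a point $a\in X$ is an $\varepsilon$-minimizer of $h\colon X\to\overline{\mathbb{R}}$ if $a\in\operatorname{dom}h$ and $h(a)-\varepsilon\le h(x)$ for all $x\in X$ (the value $h(a)=-\infty$ is allowed). A subset $C$ of a locally convex space $Y$ is e-convex if for every $y_0\notin C$ there is $y^*\in Y^*$ with $\langle y-y_0,y^*\rangle<0$ for all $y\in C$. A function $g\colon X\to\overline{\mathbb{R}}$ is e-convex if its epigraph $\{(x,r)\in X\times\mathbb{R}:g(x)\le r\}$ is e-convex in $X\times\mathbb{R}$. Coupling function: $c(x,(x^*,u^*,\alpha)):=\langle x,x^*\rangle$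 if $\langle x,u^*\rangle<\alpha$, and $+\infty$ otherwise. $\varepsilon$-$c$-subdifferential: for $h\colon X\to\overline{\mathbb{R}}$ proper with $h(x_0)\in\mathbb{R}$ and $\varepsilon\ge0$, $\partial_{c,\varepsilon}h(x_0)$ is the set of $w=(x^*,u^*,\alpha)\in W$ such that $\langle x_0,u^*\rangle<\alpha$ and $h(x)-h(x_0)\ge c(x,w)-c(x_0,w)-\varepsilon$ for all $x\in X$; if $h(x_0)\notin\mathbb{R}$, $\partial_{c,\varepsilon}h(x_0)=\emptyset$. *)

(* Defs.v *)
From HB Require Import structures.
From mathcomp Require Import all_boot all_order all_algebra.
From mathcomp Require Import all_classical all_reals all_analysis.

Set Implicit Arguments.
Unset Strict Implicit.
Unset Printing Implicit Defensive.

Import Order.TTheory GRing.Theory Num.Theory.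
Import numFieldNormedType.Exports.

Local Open Scope classical_set_scope.
Local Open Scope ring_scope.

(* [tvsType R] is locally convex (the topology has a basis of convex sets), but
   neither separated nor nontrivial; those are separate hypotheses.
   The continuous dual is the same for the given topology of [Y] and for the
   weak topology sigma(Y, Y'), so no change of topology is needed below. *)
Definition cdual (R : realType) (Y : tvsType R) : Type :=
  {l : {linear Y -> R^o} | continuous (l : Y -> R^o)}.

Definition pairing (R : realType) (Y : tvsType R) (y : Y) (l : cdual Y) : R :=
  sval l y.

Section ExtendedRealFunctions.
Context (R : realType) (T : Type).
Implicit Types h f g : T -> \bar R.

Definition edom h : set T := [set x | (h x < +oo)%E].

Definition eproper h : Prop := (forall x, h x <> -oo%E) /\ edom h !=set0.

(* The dual addition of extended reals is the one with +oo - +oo = +oo. *)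
Definition diff_fun f g : T -> \bar R := fun x => (f x - g x)%dE.

Definition eps_minimizer (eps : R) h (a : T) : Prop :=
  edom h a /\ forall x, (h a - eps%:E <= h x)%E.

End ExtendedRealFunctions.

Definition econvex_set (R : realType) (Y : tvsType R) (C : set Y) : Prop :=
  forall y0, ~ C y0 -> exists l : cdual Y, forall y, C y -> pairing (y - y0) l < 0.

Section Coupling.
Context (R : realType) (X : tvsType R).

Definition epigraph (g : X -> \bar R) : set (X * R^o)%type :=
  [set p | (g p.1 <= (p.2 : R)%:E)%E].

Definition econvex_fun (g : X -> \bar R) : Prop := econvex_set (epigraph g).

Definition Wdual : Type := (cdual X * cdual X * R)%type.

Definition coupling (x : X) (w : Wdual) : \bar R :=
  let: (xs, us, alpha) := w in
  if pairing x us < alpha then (pairing x xs)%:E else +oo%E.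

(* The first two conditions make [h x0] and [coupling x0 w] finite, so that
   no indeterminate difference occurs in the third one. *)
Definition c_subdiff (eps : R) (h : X -> \bar R) (x0 : X) : set Wdual :=
  [set w | [/\ h x0 \is a fin_num,
               pairing x0 w.1.2 < w.2 &
               forall x, (coupling x w - coupling x0 w - eps%:E
                          <= h x - h x0)%E]].

End Coupling.

(* Main.v *)
Require Import Defs.
From mathcomp Require Import all_boot all_order all_algebra.
From mathcomp Require Import all_classical all_reals all_analysis.
From mathcomp Require Import lra.

Import Order.TTheory GRing.Theory Num.Theory.
Import numFieldNormedType.Exports.

Local Open Scope classical_set_scope.
Local Open Scope ring_scope.

(** Where all values are finite, adding [f a - g a - eps <= f x - g x] to the subgradient inequality
    of [g] cancels [g], and the errors [eps] and [lambda] add up. The rest is excluding or absorbing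
    infinite values. *)

Theorem corollary5p7 (R : realType) (X : tvsType R)
  (X_separated : hausdorff_space X)
  (X_nontrivial : exists x : X, x != 0)
  (f g : X -> \bar R) (f_proper : eproper f) (g_proper : eproper g)
  (g_econvex : econvex_fun g)
  (eps : R) (eps_ge0 : 0 <= eps)
  (a : X) (a_min : eps_minimizer eps (diff_fun f g) a) :
  forall lambda : R, 0 <= lambda ->
    c_subdiff lambda g a `<=` c_subdiff (eps + lambda) f a.
Proof.
move=> lambda lambda_ge0 [[xs us] alpha] [ga_fin /= a_us sub_g].
have [f_ninfty _] := f_proper; have [g_ninfty _] := g_proper.
have [a_dom a_le] := a_min.
have fa_fin : f a \is a fin_num.
  move: a_dom ga_fin (f_ninfty a); rewrite /edom /diff_fun /=.
  by case: (f a) => [r| |]; case: (g a) => [s| |].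
split=> // x; move: (sub_g x) (a_le x) (f_ninfty x) (g_ninfty x).
rewrite /= /diff_fun a_us -(fineK fa_fin) -(fineK ga_fin).
(* If [f x] is [+oo], the target's right side is [+oo]. *)
case: (f x) => [r| |] //; last by move=> *; rewrite addye // leey.
(* [g x = +oo] with [f x] real would make the difference [-oo], below the finite bound at [a]. *)
case: (g x) => [s| |] //.
(* An infinite coupling at [x] would contradict [sub_g], as [g x] is now real. *)
case: ifP => // _.
rewrite -!EFinB !lee_fin => sub_gx a_lex _ _.
lra.
Qed.
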